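(* Let $G_1$ be an $r_1$-regular graph with $n_1$ vertices and $m_1$ edges and let $G_2$ be an arbitrary graph with $n_2$ vertices. Then the adjacency characteristic polynomial of the central edge neighborhood corona $G_1\underline{\boxdot}G_2$ is (as an identity of rational functions in $x$) $$f(A(G_1\underline{\boxdot}G_2),x)=x^{m_1}\prod_{j=1}^{n_2}(x-\lambda_j(G_2))^{m_1}\prod_{i=1}^{n_1}\Big(\big(x+1-r_1\chi_{A(G_2)}(x)-\tfrac{r_1}{x}\big)-P(\lambda_i(G_1))+\big(1-\chi_{A(G_2)}(x)-\tfrac1x\big)\lambda_i(G_1)\Big).$$
   Context: All graphs are finite, simple and connected. For a graph $G$ on $n$ vertices, $A(G)$ is its adjacency matrix with eigenvalues $\lambda_1(G)\ge\dots\ge\lambda_n(G)$ (with multiplicity). For an $n\times n$ matrix $M$, $f(M,x)=\det(xI_n-M)$, and $\chi_M(x)=\mathbf 1^T(xI_n-M)^{-1}\mathbf 1$ is the sum of all entries of $(xI_n-M)^{-1}$ (the $M$-coronal). $P$ denotes the polynomial associated with $G_1$: if $G_1$ is connected $r_1$-regular on $n_1$ vertices with distinct adjacency eigenvalues $r_1=\theta_1,\theta_2,\dots,\theta_t$, then $P(x)=n_1\prod_{k=2}^t\frac{x-\theta_k}{r_1-\theta_k}$; thus $P(A(G_1))$ is the all-ones matrix, $P(r_1)=n_1$ and $P(\theta_k)=0$ for $k\ge2$. The central graph $C(G)$ of $G$ is obtained from $G$ by subdividing each edge of $G$ exactly once and joining all pairs of distinct vertices of $G$ that are nonadjacent in $G$;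 $\tilde V(G)=V(C(G))\setminus V(G)$ is the set of subdivision vertices, corresponding to the edges of $G$. The central edge neighborhood corona $G_1\underline{\boxdot}G_2$ is obtained by taking $C(G_1)$ and $|\tilde V(G_1)|$ copies of $G_2$, and joining the neighbors in $C(G_1)$ of the $i$-th vertex of $\tilde V(G_1)$ to every vertex in the $i$-th copy of $G_2$, for each $i$. *)

(* Defs.v *)
From HB Require Import structures.
From mathcomp Require Import all_boot all_order all_algebra.
From mathcomp Require Import spectral complex.

Set Implicit Arguments.
Unset Strict Implicit.
Unset Printing Implicit Defensive.

Import Order.TTheory GRing.Theory Num.Theory.
Local Open Scope ring_scope.

Record sgraph := SGraph {
  vertex : finType;
  adj : rel vertex;
  adj_sym : symmetric adj;
  adj_irrefl : irreflexive adj
}.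

Definition connected (G : sgraph) : Prop :=
  (0 < #|vertex G|)%N /\ forall u v : vertex G, connect (@adj G) u v.

Definition regular (G : sgraph) (r : nat) : Prop :=
  forall u : vertex G, #|[set v | adj u v]| = r.

Definition edges (G : sgraph) : {set {set vertex G}} :=
  [set [set p.1; p.2] | p in [pred p : vertex G * vertex G | adj p.1 p.2]].

Definition edge (G : sgraph) : finType := {a : {set vertex G} | a \in edges G}.

Definition central_adj (G : sgraph) : rel (vertex G + edge G) :=
  fun p q => match p, q with
  | inl u, inl v => (u != v) && ~~ adj u v
  | inl u, inr a => u \in val a
  | inr a, inl v => v \in val a
  | inr _, inr _ => false
  end.

Lemma central_adj_sym G : symmetric (@central_adj G).
Proof. by move=> [u|a] [v|b] //=; rewrite eq_sym adj_sym. Qed.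

Lemma central_adj_irrefl G : irreflexive (@central_adj G).
Proof. by move=> [u|a] //=; rewrite eqxx. Qed.

Definition central (G : sgraph) : sgraph :=
  SGraph (@central_adj_sym G) (@central_adj_irrefl G).

(* The vertex [inr (a, w)] is the vertex [w] in the copy of [G2] attached to
   the subdivision vertex [inr a] of [central G1]. *)
Definition corona_adj (G1 G2 : sgraph) :
    rel (vertex (central G1) + edge G1 * vertex G2) :=
  fun p q => match p, q with
  | inl c, inl d => adj c d
  | inl c, inr (a, _) => adj c (inr a : vertex (central G1))
  | inr (a, _), inl d => adj d (inr a : vertex (central G1))
  | inr (a, w), inr (b, z) => (a == b) && adj w z
  end.

Lemma corona_adj_sym G1 G2 : symmetric (@corona_adj G1 G2).
Proof.
move=> [c|[a w]] [d|[b z]] //=; first exact: (@adj_sym (central G1)).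
by rewrite eq_sym adj_sym.
Qed.

Lemma corona_adj_irrefl G1 G2 : irreflexive (@corona_adj G1 G2).
Proof. move=> [c|[a w]] /=; first exact: (@adj_irrefl (central G1)).
by rewrite adj_irrefl andbF.
Qed.

Definition central_edge_nbhd_corona (G1 G2 : sgraph) : sgraph :=
  SGraph (@corona_adj_sym G1 G2) (@corona_adj_irrefl G1 G2).

Definition adjmx (R : pzSemiRingType) (G : sgraph) : 'M[R]_#|vertex G| :=
  \matrix_(i, j) (adj (enum_val i) (enum_val j))%:R.

Lemma adjmx_sym (R : pzSemiRingType) (G : sgraph) :
  (adjmx R G)^T = adjmx R G.
Proof. by apply/matrixP => i j; rewrite !mxE adj_sym. Qed.

Definition is_spectrum (R : realFieldType) n (M : 'M[R]_n) (s : n.-tuple R) :=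
  sorted >=%R s && (char_poly M == \prod_(a <- s) ('X - a%:P)).

Lemma char_poly_conj (F : fieldType) n (P D : 'M[F]_n) :
  P \in unitmx -> char_poly (invmx P *m D *m P) = char_poly D.
Proof.
move=> Pu; rewrite /char_poly.
have -> : char_poly_mx (invmx P *m D *m P) =
    map_mx polyC (invmx P) *m char_poly_mx D *m map_mx polyC P.
  rewrite /char_poly_mx mulmxBr mulmxBl !map_mxM; congr (_ - _).
  rewrite scalar_mxC -mulmxA -map_mxM mulVmx // map_mx1.
  by rewrite mulmx1.
rewrite !det_mulmx mulrAC -det_mulmx -map_mxM mulVmx //.
by rewrite map_mx1 det1 mul1r.
Qed.

Lemma real_splitting (R : rcfType) n (M : 'M[R]_n) :
  M^T = M -> exists s : n.-tuple R, char_poly M = \prod_(a <- s) ('X - a%:P).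
Proof.
move=> Msym; pose A := map_mx (real_complex R) M.
have Aherm : A \is hermsymmx.
  apply: realsym_hermsym.
    apply/is_hermitianmxP.
    by rewrite expr0 scale1r map_mx_id // /A map_trmx Msym.
  by apply/mxOverP => i j; rewrite mxE; apply/complex_realP; exists (M i j).
have /mxOverP dreal := hermitian_spectral_diag_real Aherm.
exists [tuple complex.Re (spectral_diag A 0 i) | i < n].
apply: (map_poly_inj (real_complex R)).
rewrite map_char_poly -/A rmorph_prod /= big_map big_enum /=.
have /orthomx_spectralP A_eq := hermitian_normalmx Aherm.
rewrite [X in char_poly X]A_eq.
rewrite char_poly_conj ?spectral_unit // char_poly_trig ?diag_mx_is_trig //.
apply: eq_bigr => i _; rewrite mxE eqxx mulr1n rmorphB /=.
by rewrite map_polyX map_polyC /= RRe_real.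
Qed.

Lemma spectrum_exists (R : rcfType) n (M : 'M[R]_n) :
  M^T = M -> exists s, is_spectrum M s.
Proof.
move=> /real_splitting [s sP].
have sz : size (sort >=%R s) == n by rewrite size_sort size_tuple.
exists (Tuple sz); apply/andP; split.
  by rewrite sort_sorted // => x y; apply: le_total.
by rewrite sP; apply/eqP/perm_big; rewrite perm_sym perm_sort.
Qed.

Definition eigenvalues (R : rcfType) (G : sgraph) : #|vertex G|.-tuple R :=
  xchoose (spectrum_exists (adjmx_sym R G)).

Definition ratC (R : idomainType) (c : R) : {fraction {poly R}} :=
  tofrac c%:P.

Definition ratX (R : idomainType) : {fraction {poly R}} := tofrac 'X.

Definition coronal (R : idomainType) n (M : 'M[R]_n) : {fraction {poly R}} :=
  ((const_mx 1 : 'rV_n) *m invmx ((ratX R)%:M - map_mx (@ratC R) M)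
     *m (const_mx 1 : 'cV_n)) 0 0.

(* [invmx] is the identity outside [unitmx]; this does not happen in
   [coronal]. *)
Lemma coronal_unitmx (R : idomainType) n (M : 'M[R]_n) :
  (ratX R)%:M - map_mx (@ratC R) M \in unitmx.
Proof.
have -> : (ratX R)%:M - map_mx (@ratC R) M =
    map_mx (@tofrac {poly R}) (char_poly_mx M).
  by rewrite map_mxB map_scalar_mx -map_mx_comp.
rewrite unitmxE det_map_mx unitfE tofrac_eq0.
exact: monic_neq0 (char_poly_monic M).
Qed.

Definition regular_poly (R : rcfType) (G : sgraph) (r : nat) :
    {poly R} :=
  #|vertex G|%:R *:
    \prod_(a <- undup (eigenvalues R G) | a != r%:R)
       ((r%:R - a)^-1 *: ('X - a%:P)).

(* Main.v *)
From HB Require Import structures.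
Require Import Defs.
From mathcomp Require Import all_boot all_order all_algebra all_fingroup.
From mathcomp Require Import mxtens ring.

Set Implicit Arguments.
Unset Strict Implicit.
Unset Printing Implicit Defensive.

Import Order.TTheory GRing.Theory Num.Theory.
Local Open Scope ring_scope.

(** Let [A1], [A2] be the adjacency matrices of [G1], [G2], let [B] be the
    incidence matrix of [G1] and [J] the all-ones matrix.  The determinants
    are taken over the field of rational functions in [x].

    Order the vertices of the corona as: vertices of [G1], edges of [G1], pairs
    of an edge of [G1] and a vertex of [G2].  Then [x - A] for the corona is the
    block matrix of [corona_char_poly_block]: its upper left block is
    [x - (J - 1 - A1)], the edges carry [x%:M], the copies of [G2] carry
    [tensmx 1 (x - A2)], and the vertices of [G1] meet the edges through [- B] and
    the copies through [B] with its columns repeated.  Eliminating the last two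
    groups ([det_copies]) leaves
    [x ^+ m1 * \det (x - A2) ^+ m1 *
     \det (x - (J - 1 - A1) - (x^-1 + chi2) *: (B *m B^T))].

    Since [G1] is [r1]-regular, [B *m B^T = r1 + A1] ([incidence_mx_gram]), so
    the matrix in the last determinant is
    [(x + 1 - r1 * chi2 - r1 / x) - J + (1 - chi2 - 1 / x) *: A1].  A real
    symmetric matrix is diagonalizable ([sym_diagonalization]).  By connectedness
    the eigenvalue [r1] of [A1] has only the constant eigenvectors
    ([connected_harmonic]), whence [J = P(A1)], diagonal in the same basis as
    [A1] ([all_ones_diagonalization]).  The determinant is then the product over
    the eigenvalues of [A1] ([det_simultaneous_diag]). *)

(** * Determinants of block matrices *)

(** Two enumerations of the same type differ by a permutation, which acts on
    rows and columns at once and so leaves the determinant unchanged. *)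
Lemma det_reindex (R : comPzRingType) (T : Type) p q (e : 'I_p -> T)
    (f : 'I_q -> T) (F : T -> T -> R) :
  bijective e -> bijective f ->
  \det (\matrix_(i, j) F (e i) (e j)) = \det (\matrix_(i, j) F (f i) (f j)).
Proof.
move=> [e' eK e'K] [f' fK f'K].
have epq : p = q.
  rewrite -[p]card_ord -[q]card_ord.
  by apply: (@bij_eq_card _ _ (f' \o e)); exists (e' \o f) => i /=;
     rewrite ?f'K ?e'K ?eK ?fK.
case: q / epq f f' fK f'K => f f' fK f'K.
have s_inj : injective (f' \o e) by apply: inj_comp; apply: can_inj; eassumption.
pose s := perm s_inj.
have -> : \matrix_(i, j) F (e i) (e j) =
    perm_mx s *m (\matrix_(i, j) F (f i) (f j)) *m (perm_mx s)^T.
  rewrite -row_permE tr_perm_mx -[perm_mx _]mul1mx mulmxA mulmx1 -col_permE.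
  by apply/matrixP => i j; rewrite !mxE !permE /= !f'K.
by rewrite !det_mulmx det_tr mulrAC det_perm -expr2 sqrr_sign mul1r.
Qed.

(** A Schur complement formula that needs no inverse of [D]: the upper right
    block is given as a left multiple of [D], and one block row operation
    clears it. *)
Lemma det_block_elim (R : comPzRingType) n p (U : 'M[R]_n) (Y : 'M_(n, p))
    (C : 'M_(p, n)) (D : 'M_p) :
  \det (block_mx U (Y *m D) C D) = \det (U - Y *m C) * \det D.
Proof.
have -> : block_mx U (Y *m D) C D =
    block_mx 1%:M Y 0 1%:M *m block_mx (U - Y *m C) 0 C D.
  by rewrite mulmx_block !mul1mx !mul0mx !add0r subrK.
by rewrite det_mulmx det_ublock !det1 mulr1 mul1r det_lblock.
Qed.

Lemma det_tens1mx (R : comPzRingType) m n (N : 'M[R]_n) :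
  \det (tensmx (1%:M : 'M_m) N) = \det N ^+ m.
Proof.
elim: m => [|m IHm].
  by rewrite expr0 -[RHS](@det1 R 0); congr (\det _); apply/matrixP; case.
(* [m.+1 * n] is [n + m * n]: the first diagonal block is split off. *)
rewrite exprS -IHm -(@det_ublock _ n (m * n) N 0).
congr (\det _); apply/matrixP => i j.
case: (mxtens_indexP i) => {i} a u; case: (mxtens_indexP j) => {j} b v.
have ix0 (x : 'I_n) : mxtens_index (ord0 : 'I_m.+1, x) = lshift (m * n) x.
  exact: val_inj.
have ixS c (x : 'I_n) :
    mxtens_index (lift ord0 c : 'I_m.+1, x) = rshift n (mxtens_index (c, x)).
  by apply: val_inj; rewrite /= mulSn addnA.
rewrite tensmxE mxE; case: (unliftP ord0 a) => [a'|] ->;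
  case: (unliftP ord0 b) => [b'|] ->; rewrite ?ix0 ?ixS.
- by rewrite block_mxEdr tensmxE mxE (inj_eq lift_inj).
- by rewrite block_mxEdl mxE eq_sym (negPf (neq_lift _ _)) mul0r.
- by rewrite block_mxEur mxE (negPf (neq_lift _ _)) mul0r.
- by rewrite block_mxEul eqxx mul1r.
Qed.

(** [w] consecutive copies of each column of [B]; columns are indexed by pairs
    (column of [B], copy) through [mxtens_index]. *)
Definition copy_mx (R : pzSemiRingType) n m w (B : 'M[R]_(n, m)) :
    'M[R]_(n, m * w) := \matrix_(i, k) B i (mxtens_unindex k).1.

(** The Schur complement for the block matrix of the corona: [x%:M] and
    [tensmx 1%:M N] are the blocks of the subdivision vertices and of the copies of
    the second graph.  Each copy contributes the sum [chi] of all entries of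
    [invmx N]. *)
Lemma det_copies (K : fieldType) n m w (U : 'M[K]_n) (B : 'M_(n, m)) (x : K)
    (N : 'M_w) (B' := copy_mx w B)
    (chi := ((const_mx 1 : 'rV_w) *m invmx N *m (const_mx 1 : 'cV_w)) 0 0) :
  x != 0 -> N \in unitmx ->
  \det (block_mx U (row_mx (- B) (- B')) (col_mx (- B^T) (- B'^T))
     (block_mx x%:M 0 0 (tensmx 1%:M N))) =
  x ^+ m * \det N ^+ m * \det (U - (x^-1 + chi) *: (B *m B^T)).
Proof.
move=> x0 Nu.
(* [s] is the row of column sums of [invmx N]; only [s *m N = 1] and the sum
   [chi] of its entries matter below. *)
pose s := (const_mx 1 : 'rV_w) *m invmx N.
have sN v : \sum_u s 0 u * N u v = 1.
  have := congr1 (fun A : 'M_(1, w) => A 0 v) (mulmxKV Nu (const_mx 1)).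
  by rewrite /= -/s !mxE.
have chiE : chi = \sum_u s 0 u.
  by rewrite /chi mxE; apply: eq_bigr => u _; rewrite [const_mx _ _ _]mxE mulr1.
move: s chi sN chiE => s chi sN chiE.
pose S : 'M_(n, m * w) :=
  \matrix_(i, k) (B i (mxtens_unindex k).1 * s 0 (mxtens_unindex k).2).
have sumE (F : 'I_m -> 'I_w -> K) :
    \sum_(k < m * w) F (mxtens_unindex k).1 (mxtens_unindex k).2 =
    \sum_i \sum_j F i j.
  rewrite pair_big (reindex (@mxtens_index m w)); last first.
    by exists (@mxtens_unindex m w) => k _; rewrite ?mxtens_indexK ?mxtens_unindexK.
  by apply: eq_bigr => -[i j] _; rewrite mxtens_indexK.
have SN : S *m tensmx 1%:M N = B'.
  apply/matrixP => i k; case: (mxtens_indexP k) => {k} a v.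
  rewrite !mxE mxtens_indexK /=; under eq_bigr do rewrite !mxE mxtens_indexK.
  transitivity (\sum_b \sum_u (B i b * s 0 u * ((b == a)%:R * N u v))).
    exact: (sumE (fun b u => B i b * s 0 u * ((b == a)%:R * N u v))).
  rewrite (bigD1 a) //= eqxx [X in _ + X]big1 ?addr0; last first.
    by move=> b /negPf ba; rewrite big1 // => u _; rewrite ba mul0r mulr0.
  under eq_bigr do rewrite mul1r -mulrA.
  by rewrite -mulr_sumr sN mulr1.
have SB : S *m B'^T = chi *: (B *m B^T).
  apply/matrixP => i j; rewrite !mxE.
  under eq_bigr do rewrite !mxE.
  transitivity (\sum_b \sum_u (B i b * s 0 u * B j b)).
    exact: (sumE (fun b u => B i b * s 0 u * B j b)).
  rewrite mulr_sumr; apply: eq_bigr => b _.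
  by rewrite -mulr_suml -mulr_sumr -chiE mxE mulrAC mulrC.
have -> : row_mx (- B) (- B') =
    row_mx (- (x^-1 *: B)) (- S) *m block_mx x%:M 0 0 (tensmx 1%:M N).
  rewrite mul_row_block !mulmx0 addr0 add0r !mulNmx SN mul_mx_scalar scalerA.
  by rewrite mulfV // scale1r.
rewrite det_block_elim det_ublock det_scalar det_tens1mx mulrC.
congr (_ * \det (_ - _)).
by rewrite mul_row_col !mulNmx !mulmxN !opprK SB -scalemxAl scalerDl.
Qed.

(** * The incidence matrix *)

Lemma edgesP (G : sgraph) (a : {set vertex G}) :
  reflect (exists u v, adj u v /\ a = [set u; v]) (a \in edges G).
Proof.
apply: (iffP imsetP) => [[[u v] /= uv ->]|[u [v [uv ->]]]].
  by exists u, v.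
by exists (u, v).
Qed.

Lemma edges2 (G : sgraph) (u v : vertex G) : ([set u; v] \in edges G) = adj u v.
Proof.
apply/edgesP/idP => [[a [b [ab e]]]|uv]; last by exists u, v.
have : a \in [set u; v] by rewrite e !inE eqxx.
have : b \in [set u; v] by rewrite e !inE eqxx orbT.
have : v \in [set a; b] by rewrite -e !inE eqxx orbT.
have : u \in [set a; b] by rewrite -e !inE eqxx.
rewrite !inE => /orP[]/eqP-> /orP[]/eqP->; rewrite ?ab // 1?adj_sym ?ab //.
all: by rewrite ?orbb => /eqP ba /eqP ba'; move: ab; rewrite ?ba ?ba' adj_irrefl.
Qed.

Lemma edge_at_ex (G : sgraph) (u : vertex G) (a : {set vertex G}) :
  a \in edges G -> u \in a -> exists2 w, adj u w & a = [set u; w].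
Proof.
case/edgesP => p [q [pq ->]]; rewrite !inE => /orP[]/eqP->; first by exists q.
by exists p; rewrite 1?adj_sym // setUC.
Qed.

(** Two distinct vertices lie on a common edge exactly when they are adjacent,
    and [w |-> [set u; w]] matches the neighbors of [u] with the edges at
    [u]. *)
Lemma card_edges_at (G : sgraph) (u v : vertex G) r : regular G r ->
  #|[set a in edges G | (u \in a) && (v \in a)]| =
  (if u == v then r else adj u v)%N.
Proof.
move=> Gr; case: eqVneq => [<-|uv].
  rewrite -(Gr u) -(card_in_imset (f := fun w => [set u; w])).
    congr #|pred_of_set _|; apply/setP => a; rewrite !inE andbb.
    apply/andP/imsetP => [[aE ua]|[w]]; last first.
      by rewrite inE => uw ->; rewrite edges2 uw !inE eqxx.
    by have [w uw ->] := edge_at_ex aE ua; exists w; rewrite ?inE.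
  move=> w w'; rewrite !inE => uw uw' /setP/(_ w); rewrite !inE eqxx orbT.
  by case: eqP => [wu|_ /esym/eqP //]; rewrite wu adj_irrefl in uw.
transitivity #|[set a in [set [set u; v]] | adj u v]|; last first.
  case: (adj u v).
    rewrite -[RHS](cards1 [set u; v]).
    by apply: eq_card => a; rewrite !inE andbT.
  by apply: eq_card0 => a; rewrite !inE andbF.
apply: eq_card => a; rewrite !inE; apply/idP/idP.
  case/and3P => aE ua va; have [w uw aw] := edge_at_ex aE ua.
  move: va; rewrite aw !inE eq_sym (negPf uv) /= => /eqP vw.
  by rewrite vw eqxx uw.
by case/andP => /eqP-> uv'; rewrite edges2 uv' !inE !eqxx orbT.
Qed.

(** The vertex-edge incidence matrix, rows and columns being indexed by the
    enumerations of vertices and edges. *)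
Definition incidence_mx (G : sgraph) (R : pzSemiRingType) :
    'M[R]_(#|vertex G|, #|edge G|) :=
  \matrix_(i < #|vertex G|, a < #|edge G|)
     ((enum_val i : vertex G) \in val (enum_val a : edge G))%:R.

Lemma incidence_mx_gram (G : sgraph) (R : pzSemiRingType) r : regular G r ->
  incidence_mx G R *m (incidence_mx G R)^T = r%:R%:M + adjmx R G.
Proof.
move=> Gr; apply/matrixP => i j; rewrite !mxE.
set u := enum_val i; set v := enum_val j.
transitivity (#|[set a in edges G | (u \in a) && (v \in a)]|%:R : R).
  under eq_bigr do rewrite !mxE -natrM mulnb.
  rewrite -natr_sum -big_mkcond /= sum1_card.
  rewrite -(card_imset _ enum_val_inj) -(card_imset _ val_inj).
  congr (_%:R); apply: eq_card => a; rewrite inE.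
  apply/imsetP/andP => [[b /imsetP[k + ->] ->]|[aE ua]].
    by move=> kP; split; [exact: valP|].
  exists (Sub a aE : edge G) => //.
  apply/imsetP; exists (enum_rank (Sub a aE : edge G)).
    by rewrite -topredE /= enum_rankK.
  by rewrite enum_rankK.
rewrite (card_edges_at u v Gr) (inj_eq enum_val_inj).
case: eqVneq => [ij|_]; last by rewrite mulr0n add0r.
by rewrite /v -ij -/u adj_irrefl mulr1n addr0.
Qed.

(** * Diagonalization of symmetric matrices *)

(** If [N] is symmetric and [N ^+ 2 = 0], the diagonal entries of [N ^+ 2] are
    vanishing sums of squares of the entries of [N]; a power [2 ^ k] reduces to
    this case. *)
Lemma sym_nilpotent (R : realDomainType) n (M : 'M[R]_n.+1) k :
  M^T = M -> M ^+ k = 0 -> M = 0.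
Proof.
have sq0 (N : 'M[R]_n.+1) : N^T = N -> N ^+ 2 = 0 -> N = 0.
  move=> Ns N2; apply/matrixP => i j; rewrite mxE.
  have /matrixP/(_ i i) := N2; rewrite expr2 !mxE => S0.
  have /psumr_eq0P : forall l, true -> 0 <= N i l * N l i.
    by move=> l _; rewrite -{2}Ns mxE -expr2 sqr_ge0.
  by move=> /(_ S0 j isT)/eqP; rewrite -{2}Ns mxE mulf_eq0 orbb => /eqP.
have trX (N : 'M[R]_n.+1) l : N^T = N -> (N ^+ l)^T = N ^+ l.
  move=> Ns; elim: l => [|l IHl]; first by rewrite expr0 trmx1.
  by rewrite {1}exprS trmx_mul IHl Ns exprSr.
move=> Ms Mk; have : M ^+ (2 ^ k) = 0.
  by rewrite -(subnK (ltnW (ltn_expl k (ltnSn 1)))) exprD Mk mulr0.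
elim: k {Mk} => [|k IHk]; first by rewrite expn0 expr1.
by rewrite expnSr exprM => /(sq0 _ (trX _ _ Ms)).
Qed.

(** Spectral theorem for a symmetric matrix whose characteristic polynomial
    splits.  The product of the distinct ['X - a%:P] takes at [A] a symmetric
    nilpotent, hence zero, value; so the minimal polynomial has simple
    roots. *)
Lemma sym_diagonalization (R : realFieldType) n (A : 'M[R]_n) (s : seq R) :
  A^T = A -> char_poly A = \prod_(a <- s) ('X - a%:P) ->
  exists (V : 'M[R]_n) (d : 'rV[R]_n),
    [/\ V \in unitmx, A = invmx V *m diag_mx d *m V &
        perm_eq s [seq d 0 i | i <- enum 'I_n]].
Proof.
move=> As Ac.
suff [V Vu [d Ad]] : exists2 V : 'M[R]_n, V \in unitmx &
    exists d, A = invmx V *m diag_mx d *m V.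
  exists V, d; split=> //; apply: prod_XsubC_eq.
  rewrite -Ac Ad char_poly_conj // char_poly_trig ?diag_mx_is_trig //.
  by rewrite big_map big_enum; apply: eq_bigr => i _; rewrite mxE eqxx.
case: n A As Ac => [|n] A As Ac.
  exists 1%:M; rewrite ?unitmx1 //; exists 0; apply/matrixP; case=> //.
pose q := \prod_(a <- undup s) ('X - a%:P).
have trH (p : {poly R}) : (horner_mx A p)^T = horner_mx A p.
  elim/poly_ind: p => [|p c IHp]; first by rewrite rmorph0 trmx0.
  rewrite rmorphD rmorphM /= horner_mx_X horner_mx_C linearD /= tr_scalar_mx.
  rewrite trmx_mul As IHp; congr (_ + _).
  by apply: comm_mx_horner.
have qA : horner_mx A q = 0.
  apply: (@sym_nilpotent _ _ _ (size s)); first exact: trH.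
  rewrite -rmorphXn /=; apply/eqP; rewrite -dvd_mxminpoly.
  apply: dvdp_trans (mxminpoly_dvd_char A) _; rewrite Ac.
  (* Each of the [size s] factors of the characteristic polynomial divides
     [q]; the induction runs over a second copy of [s], as [q] is fixed. *)
  have: {subset s <= s} by [].
  elim: {1 3 4}s => [|a t IHt] /= ts; first by rewrite big_nil dvd1p.
  rewrite big_cons exprS dvdp_mul //.
    by rewrite dvdp_XsubCl /q root_prod_XsubC mem_undup ts // mem_head.
  by apply: IHt => b bt; rewrite ts // inE bt orbT.
have [V Vu VA] : diagonalizable A.
  apply/diagonalizableP; exists (undup s); first exact: undup_uniq.
  exact: mxminpoly_min.
exists V => //; have /(diagonalizable_forLR Vu)[d ->] := VA.
by exists d; rewrite mxpoly.conjumx ?unitmx_inv // invmxK.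
Qed.

Lemma det_conj (K : fieldType) n (V M : 'M[K]_n) : V \in unitmx ->
  \det (invmx V *m M *m V) = \det M.
Proof.
by move=> Vu; rewrite !det_mulmx mulrAC -det_mulmx mulVmx // det1 mul1r.
Qed.

Lemma det_simultaneous_diag (K : fieldType) n (V A J : 'M[K]_n)
    (d e : 'rV_n) (b c : K) :
  V \in unitmx -> A = invmx V *m diag_mx d *m V ->
  J = invmx V *m diag_mx e *m V ->
  \det (c%:M - J + b *: A) = \prod_i (c - e 0 i + b * d 0 i).
Proof.
move=> Vu -> ->.
have -> : c%:M - invmx V *m diag_mx e *m V + b *: (invmx V *m diag_mx d *m V)
    = invmx V *m diag_mx (const_mx c - e + b *: d) *m V.
  rewrite linearD linearB linearZ /= diag_const_mx mulmxDr mulmxBr mulmxDl.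
  by rewrite mulmxBl mul_mx_scalar -scalemxAl mulVmx // scalemx1
    -scalemxAr -scalemxAl.
by rewrite det_conj // det_diag; apply: eq_bigr => i _; rewrite !mxE.
Qed.

(** * The spectrum of a connected regular graph *)

(** The eigenspace of the degree [r] consists of constant functions: at a
    vertex where [f] is maximal, the average of [f] over the neighbors equals
    this maximum, so [f] is maximal at each neighbor. *)
Lemma connected_harmonic (R : realDomainType) (G : sgraph) r (f : vertex G -> R) :
  connected G -> regular G r ->
  (forall u, \sum_(v | adj u v) f v = r%:R * f u) ->
  forall u v, f u = f v.
Proof.
move=> [/card_gt0P[u0 _] Gc] Gr fH.
have [m _ mP] := Order.TotalTheory.arg_maxP f (erefl : xpredT u0).
suff fpath p w : path (@adj G) w p -> f w = f m -> f (last w p) = f m.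
  suff fm u : f u = f m by move=> u v; rewrite !fm.
  by have /connectP[p mp ->] := Gc m u; apply: fpath.
elim: p w => //= v p IHp w /andP[wv pth] fw; apply: IHp => //.
have S0 : \sum_(v | adj w v) (f m - f v) = 0.
  rewrite sumrB fH fw sumr_const mulr_natl.
  suff -> : #|adj w| = r by rewrite subrr.
  by rewrite -(Gr w); apply: eq_card => z; rewrite inE.
have /psumr_eq0P : forall v, adj w v -> 0 <= f m - f v.
  by move=> z _; rewrite subr_ge0; apply: mP.
by move=> /(_ S0 v wv)/eqP; rewrite subr_eq0 => /eqP.
Qed.

Lemma char_poly_eigenvalues (R : rcfType) (G : sgraph) :
  char_poly (adjmx R G) = \prod_(a <- eigenvalues R G) ('X - a%:P).
Proof. by have /andP[_ /eqP] := xchooseP (spectrum_exists (adjmx_sym R G)). Qed.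

Lemma regular_poly_degree (R : rcfType) (G : sgraph) r :
  (regular_poly R G r).[r%:R] = #|vertex G|%:R.
Proof.
rewrite /regular_poly hornerZ horner_prod big1 ?mulr1 // => a ar.
by rewrite hornerZ hornerXsubC mulVf // subr_eq0 eq_sym.
Qed.

Lemma regular_poly_eigenvalue (R : rcfType) (G : sgraph) r a :
  a \in (eigenvalues R G : seq R) -> a != r%:R -> (regular_poly R G r).[a] = 0.
Proof.
move=> aG ar; rewrite /regular_poly hornerZ horner_prod.
rewrite (big_rem a) ?mem_undup //= ar hornerZ hornerXsubC subrr.
by rewrite mulr0 mul0r mulr0.
Qed.

Lemma adjmx_mulE (R : pzSemiRingType) (G : sgraph) p
    (X : 'M[R]_(#|vertex G|, p)) u j :
  (adjmx R G *m X) (enum_rank u) j = \sum_(v | adj u v) X (enum_rank v) j.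
Proof.
rewrite mxE (reindex (@enum_rank (vertex G))) /=; last first.
  by exists enum_val => v _; rewrite ?enum_rankK ?enum_valK.
rewrite [RHS]big_mkcond; apply: eq_bigr => v _; rewrite mxE !enum_rankK.
by case: adj; rewrite ?mul1r ?mul0r.
Qed.

(** [connected_harmonic], applied to each column of [X]. *)
Lemma adjmx_eigen_const (R : realDomainType) (G : sgraph) r p
    (X : 'M[R]_(#|vertex G|, p)) :
  connected G -> regular G r -> adjmx R G *m X = r%:R *: X ->
  forall i i' j, X i j = X i' j.
Proof.
move=> Gc Gr AX i i' j; rewrite -[i]enum_valK -[i']enum_valK.
apply: (connected_harmonic (f := fun u => X (enum_rank u) j) Gc Gr) => u.
by rewrite -adjmx_mulE AX mxE.
Qed.

(** The all-ones matrix is [P(A)], where [P] is the polynomial of the regular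
    graph, and [P(A)] is expressed through a diagonalization of [A]. *)
Lemma all_ones_diagonalization (R : rcfType) (G : sgraph) r
    (V : 'M[R]_#|vertex G|) (d : 'rV_#|vertex G|) :
  connected G -> regular G r -> V \in unitmx ->
  adjmx R G = invmx V *m diag_mx d *m V ->
  perm_eq (eigenvalues R G) [seq d 0 i | i <- enum 'I_#|vertex G|] ->
  const_mx 1 = invmx V *m diag_mx (\row_i (regular_poly R G r).[d 0 i]) *m V.
Proof.
move=> Gc Gr Vu Ad sd; set e := \row_i _; set E := _ *m V.
(* [P] takes the number of vertices as its value at the degree, and vanishes at
   the other eigenvalues. *)
have eE i : e 0 i = if d 0 i == r%:R then #|vertex G|%:R else 0.
  rewrite mxE; case: eqP => [->|/eqP dr]; first exact: regular_poly_degree.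
  rewrite regular_poly_eigenvalue // (perm_mem sd).
  by apply/mapP; exists i; rewrite ?mem_enum.
clearbody e.
have de : diag_mx d *m diag_mx e = r%:R *: diag_mx e.
  rewrite mulmx_diag -linearZ; congr diag_mx; apply/rowP => i.
  by rewrite mxE [RHS]mxE eE; case: eqP => [->|_]; rewrite ?mulr0.
have ed : diag_mx e *m diag_mx d = r%:R *: diag_mx e.
  by rewrite diag_mxC.
(* The rows and columns of [E] are eigenvectors of [A] for the degree [r], so
   [E] is a constant matrix; its row sums then fix the constant. *)
have AE : adjmx R G *m E = r%:R *: E.
  by rewrite Ad /E -!mulmxA mulKVmx // (mulmxA (diag_mx d)) de
    -scalemxAl -scalemxAr.
have EA : E *m adjmx R G = r%:R *: E.
  by rewrite Ad /E -!mulmxA mulKVmx // (mulmxA (diag_mx e)) ed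
    -scalemxAl -scalemxAr.
have AEt : adjmx R G *m E^T = r%:R *: E^T.
  by rewrite -{1}[adjmx R G]adjmx_sym -trmx_mul EA linearZ.
have cst i i' j j' : E i j = E i' j'.
  rewrite (adjmx_eigen_const Gc Gr AE i i').
  by have := adjmx_eigen_const Gc Gr AEt j j' i'; rewrite !mxE.
pose o := const_mx 1 : 'cV[R]_#|vertex G|.
have Ao : adjmx R G *m o = r%:R *: o.
  apply/colP => i; rewrite -[i]enum_valK adjmx_mulE !mxE mulr1.
  rewrite (eq_bigr (fun=> 1)) => [|v _]; last by rewrite mxE.
  rewrite sumr_const -(Gr (enum_val i)); congr (_ *+ _).
  by apply: eq_card => v; rewrite inE.
have dVo : diag_mx d *m (V *m o) = r%:R *: (V *m o).
  by rewrite scalemxAr -Ao Ad !mulmxA mulmxV // mul1mx.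
have eVo : diag_mx e *m (V *m o) = #|vertex G|%:R *: (V *m o).
  move: (V *m o) dVo => y; rewrite !mul_diag_mx => dy; apply/colP => i.
  have /colP/(_ i) := dy; rewrite !mxE eE; case: eqP => // /eqP dr /eqP.
  rewrite -subr_eq0 -mulrBl mulf_eq0 subr_eq0 (negPf dr) /= => /eqP->.
  by rewrite !mulr0.
have Eo : E *m o = #|vertex G|%:R *: o.
  by rewrite /E -!mulmxA eVo -scalemxAr mulKmx.
clearbody E.
have n0 : #|vertex G|%:R != 0 :> R.
  by case: Gc => + _; rewrite pnatr_eq0 lt0n.
apply/matrixP => i j; rewrite mxE; apply: (mulfI n0); rewrite mulr1.
have /colP/(_ i) := Eo; rewrite !mxE mulr1 => {1}<-.
rewrite (eq_bigr (fun=> E i j)) => [|k _]; last by rewrite mxE mulr1; apply: cst.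
by rewrite sumr_const card_ord mulr_natl.
Qed.

(** * The characteristic matrix of the corona *)

(** The embedding of the scalars as constant rational functions is a ring
    morphism. *)
HB.instance Definition _ (R : idomainType) :=
  GRing.RMorphism.copy (@ratC R) (@tofrac {poly R} \o polyC).

Lemma tofrac_char_poly (R : idomainType) n (M : 'M[R]_n) :
  tofrac (char_poly M) = \det ((ratX R)%:M - map_mx (@ratC R) M).
Proof.
rewrite /char_poly -det_map_mx; congr (\det _).
by rewrite map_mxB map_scalar_mx -map_mx_comp.
Qed.

(** The vertices of the corona in the order: vertices of [G1], edges of [G1],
    then pairs of an edge of [G1] and a vertex of [G2]. *)
Definition corona_enum (G1 G2 : sgraph)
    (k : 'I_(#|vertex G1| + (#|edge G1| + #|edge G1| * #|vertex G2|))) :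
    vertex (central_edge_nbhd_corona G1 G2) :=
  match split k with
  | inl i => inl (inl (enum_val i))
  | inr k => match split k with
    | inl a => inl (inr (enum_val a))
    | inr l => inr (enum_val (mxtens_unindex l).1,
                    enum_val (mxtens_unindex l).2)
    end
  end.

Lemma corona_enumV (G1 G2 : sgraph) i :
  @corona_enum G1 G2 (lshift _ i) = inl (inl (enum_val i)).
Proof. by rewrite /corona_enum (unsplitK (inl i)). Qed.

Lemma corona_enumE (G1 G2 : sgraph) a :
  @corona_enum G1 G2 (rshift _ (lshift _ a)) = inl (inr (enum_val a)).
Proof.
by rewrite /corona_enum (unsplitK (inr (lshift _ a))) (unsplitK (inl a)).
Qed.

Lemma corona_enumC (G1 G2 : sgraph) a v :
  @corona_enum G1 G2 (rshift _ (rshift _ (mxtens_index (a, v)))) =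
  inr (enum_val a, enum_val v).
Proof.
rewrite /corona_enum (unsplitK (inr (rshift _ _))) (unsplitK (inr _)).
by rewrite mxtens_indexK.
Qed.

Lemma corona_enum_bij (G1 G2 : sgraph) : bijective (@corona_enum G1 G2).
Proof.
exists (fun t : vertex (central_edge_nbhd_corona G1 G2) => match t with
  | inl (inl u) => lshift _ (enum_rank u)
  | inl (inr a) => rshift _ (lshift _ (enum_rank a))
  | inr (a, v) => rshift _ (rshift _ (mxtens_index (enum_rank a, enum_rank v)))
  end).
  move=> k; case: (split_ordP k) => {}k ->.
    by rewrite corona_enumV enum_valK.
  case: (split_ordP k) => {}k ->; first by rewrite corona_enumE enum_valK.
  by case: (mxtens_indexP k) => a v; rewrite corona_enumC !enum_valK.
case=> [[u|a]|[a v]].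
- by rewrite corona_enumV enum_rankK.
- by rewrite corona_enumE enum_rankK.
- by rewrite corona_enumC !enum_rankK.
Qed.

Lemma corona_char_poly_block (R : idomainType) (G1 G2 : sgraph)
  (x := ratX R) (A1 := map_mx (@ratC R) (adjmx R G1))
  (B := incidence_mx G1 {fraction {poly R}}) :
  tofrac (char_poly (adjmx R (central_edge_nbhd_corona G1 G2))) =
  \det (block_mx (x%:M - (const_mx 1 - 1%:M - A1))
     (row_mx (- B) (- copy_mx #|vertex G2| B))
     (col_mx (- B^T) (- (copy_mx #|vertex G2| B)^T))
     (block_mx x%:M 0 0
        (tensmx 1%:M (x%:M - map_mx (@ratC R) (adjmx R G2))))).
Proof.
rewrite tofrac_char_poly -/x.
pose T := vertex (central_edge_nbhd_corona G1 G2).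
(* The entries of [x%:M - A], indexed by vertices instead of ordinals. *)
pose F (s t : T) : {fraction {poly R}} := x *+ (s == t) - (adj s t)%:R.
transitivity (\det (\matrix_(i, j < #|T|) F (enum_val i) (enum_val j))).
  congr (\det _); apply/matrixP => i j.
  by rewrite !mxE /F (inj_eq enum_val_inj) rmorph_nat.
rewrite (det_reindex _ _ (corona_enum_bij G1 G2)); last first.
  by exists enum_rank => k; rewrite ?enum_rankK ?enum_valK.
congr (\det _); apply/matrixP => i j; rewrite mxE.
have xE p (k l : 'I_p) : (x%:M : 'M_p) k l = x *+ (k == l) by rewrite mxE.
case: (split_ordP i) => {}i ->; last (case: (split_ordP i) => {}i ->;
    last case: (mxtens_indexP i) => {i} a v);
case: (split_ordP j) => {}j ->; try (case: (split_ordP j) => {}j ->;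
    last case: (mxtens_indexP j) => {j} b z);
rewrite ?(block_mxEul, block_mxEur, block_mxEdl, block_mxEdr)
  ?(row_mxEl, row_mxEr, col_mxEu, col_mxEd)
  ?(corona_enumV, corona_enumE, corona_enumC) /F.
- rewrite [RHS]mxE xE ![in RHS]mxE rmorph_nat -[_ == _]/(enum_val i == enum_val j).
  rewrite -[adj _ _]/((enum_val i != enum_val j) &&
    ~~ adj (enum_val i) (enum_val j)).
  rewrite (inj_eq enum_val_inj); case: eqVneq => [->|_] /=.
    by rewrite adj_irrefl subrr !subr0.
  by rewrite subr0; case: adj; rewrite /= ?subr0 ?subrr.
- by rewrite !mxE sub0r.
- by rewrite !mxE mxtens_indexK sub0r.
- by rewrite !mxE sub0r.
- by rewrite xE subr0 -[_ == _]/(enum_val i == enum_val j) (inj_eq enum_val_inj).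
- by rewrite mxE subr0.
- by rewrite !mxE mxtens_indexK sub0r.
- by rewrite mxE subr0.
rewrite tensmxE mxE [in RHS]mxE xE ![in RHS]mxE rmorph_nat.
rewrite -[_ == _]/((enum_val a == enum_val b) && (enum_val v == enum_val z)).
rewrite -[adj _ _]/((enum_val a == enum_val b) && adj (enum_val v) (enum_val z)).
rewrite !(inj_eq enum_val_inj); case: eqVneq => _ /=; first by rewrite mul1r.
by rewrite mul0r subr0.
Qed.

(** * The characteristic polynomial of the corona *)

Theorem theorem5p1 (R : rcfType) (G1 G2 : sgraph) (r1 n1 m1 n2 : nat)
    (connected_G1 : connected G1) (connected_G2 : connected G2)
    (regular_G1 : regular G1 r1)
    (n1E : #|vertex G1| = n1) (m1E : #|edges G1| = m1)
    (n2E : #|vertex G2| = n2) :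
  let x := ratX R in
  let chi2 := coronal (adjmx R G2) in
  let lambda1 (i : 'I_n1) := (eigenvalues R G1)`_i in
  let lambda2 (j : 'I_n2) := (eigenvalues R G2)`_j in
  let P := regular_poly R G1 r1 in
  tofrac (char_poly (adjmx R (central_edge_nbhd_corona G1 G2))) =
  x ^+ m1 * \prod_(j < n2) (x - ratC (lambda2 j)) ^+ m1 *
  \prod_(i < n1)
    ((x + 1 - r1%:R * chi2 - r1%:R / x)
     - ratC P.[lambda1 i]
     + (1 - chi2 - 1 / x) * ratC (lambda1 i)).
Proof.
case: n1 / n1E; case: n2 / n2E => x chi2 lambda1 lambda2 P.
have x0 : x != 0 by rewrite tofrac_eq0 polyX_eq0.
have eE : #|edge G1| = m1 by rewrite card_sig.
rewrite -eE corona_char_poly_block det_copies ?coronal_unitmx //.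
rewrite -/x -/(coronal (adjmx R G2)) -/chi2.
congr (_ * _ * _).
  rewrite -tofrac_char_poly char_poly_eigenvalues rmorph_prod /= prodrXl.
  rewrite (big_nth 0) size_tuple big_mkord; congr (_ ^+ _).
  by apply: eq_bigr => j _; rewrite tofracB.
rewrite (incidence_mx_gram _ regular_G1).
have -> : adjmx {fraction {poly R}} G1 = map_mx (@ratC R) (adjmx R G1).
  by apply/matrixP => i j; rewrite !mxE rmorph_nat.
have [V [d [Vu Ad sd]]] :=
  sym_diagonalization (adjmx_sym R G1) (char_poly_eigenvalues R G1).
have Jd := all_ones_diagonalization connected_G1 regular_G1 Vu Ad sd.
set AK := map_mx _ _.
pose c := x + 1 - r1%:R * chi2 - r1%:R / x; pose b := 1 - chi2 - 1 / x.
have -> : x%:M - (const_mx 1 - 1%:M - AK) - (x^-1 + chi2) *: (r1%:R%:M + AK)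
    = c%:M - const_mx 1 + b *: AK.
  apply/matrixP => i j; rewrite /c /b; move: AK => AK; rewrite !mxE.
  by case: eqP => _; rewrite ?mulr1n ?mulr0n; ring.
have mapconj (e : 'rV_#|vertex G1|) :
    map_mx (@ratC R) (invmx V *m diag_mx e *m V) =
    invmx (map_mx (@ratC R) V) *m diag_mx (map_mx (@ratC R) e)
      *m map_mx (@ratC R) V.
  by rewrite !map_mxM map_diag_mx map_invmx.
rewrite (det_simultaneous_diag (V := map_mx (@ratC R) V)
  (d := map_mx (@ratC R) d)
  (e := map_mx (@ratC R) (\row_i P.[d 0 i]))); first last.
- by rewrite -mapconj -Jd; apply/matrixP => i j; rewrite !mxE rmorph1.
- by rewrite -mapconj -Ad.
- by rewrite map_unitmx.
transitivity (\prod_(a <- eigenvalues R G1) (c - ratC P.[a] + b * ratC a)).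
  rewrite (perm_big _ sd) big_map big_enum /=.
  by apply: eq_bigr => i _; rewrite !mxE.
by rewrite (big_nth 0) size_tuple big_mkord.
Qed.
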